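(* Let $\mathcal L=\langle F,M,\mathrm{mng},\models\rangle$ be any logic with formula algebra $\mathfrak F$. Define, for $H\subseteq F\times F$ and $\tau,\sigma\in F$: $H\vdash_{\mathcal L}\langle\tau,\sigma\rangle$ iff for every endomorphism $f$ of $\mathfrak F$ and every $\mathfrak M\in M$, if $f(H)\subseteq\ker(\mathrm{mng}_{\mathfrak M})$ then $\langle f\tau,f\sigma\rangle\in\ker(\mathrm{mng}_{\mathfrak M})$, where $f(H)=\{\langle f\phi,f\psi\rangle:\langle\phi,\psi\rangle\in H\}$. Then: (i) $\vdash_{\mathcal L}$ is the largest substitutional and sound deductive system in $\mathcal L$ (i.e. it is substitutional and sound, and every substitutional and sound deductive system $\vdash$ in $\mathcal L$ satisfies $\vdash\subseteq\vdash_{\mathcal L}$); (ii) for all $H\subseteq F\times F$ and $\phi,\psi\in F$: $H\vdash_{\mathcal L}\langle\phi,\psi\rangle$ iff $\mathrm{Alg}_m(\mathcal L)\models\bigwedge H\to[\phi=\psi]$.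
   Context: A logic is a tuple $\mathcal L=\langle F,M,\mathrm{mng},\models\rangle$ where: $\mathrm{Cn}$ is a similarity type (the connectives) and $P$ is a set (the atomic formulas) such that no $p\in P$ is a term built by the connectives from elements of $P\setminus\{p\}$; $F$ is the universe of the term algebra $\mathfrak F=\mathfrak F(P,\mathrm{Cn})$; $M$ is a class (of models); $\models\subseteq M\times F$; and $\mathrm{mng}$ assigns to each $\mathfrak M\in M$ a homomorphism $\mathrm{mng}_{\mathfrak M}$ from $\mathfrak F$ into some algebra of type $\mathrm{Cn}$, such that $\mathrm{mng}_{\mathfrak M}(\phi)=\mathrm{mng}_{\mathfrak M}(\psi)$ and $\mathfrak M\models\phi$ imply $\mathfrak M\models\psi$. $\mathrm{Alg}_m(\mathcal L)=\{\mathrm{mng}_{\mathfrak M}(\mathfrak F):\mathfrak M\in M\}$. A (2-dimensional) deductive system in $\mathcal L$ is a consequence relation $\vdash$ (in the sense of Blok–Pigozzi) between subsets $H\subseteq F\times F$ and elements of $F\times F$. A set $\Sigma\subseteq F\times F$ is closed under $\vdash$ if $H\subseteq\Sigma$ and $H\vdash\langle\tau,\sigma\rangle$ imply $\langle\tau,\sigma\rangle\in\Sigma$. $\vdash$ is sound if $\ker(\mathrm{mng}_{\mathfrak M})$ is closed under $\vdash$ for every $\mathfrak M\in M$, and substitutional if $H\vdash\langle\tau,\sigma\rangle$ implies $f(H)\vdash\langle f\tau,f\sigma\rangle$ for every endomorphism $f$ of $\mathfrak F$. $\mathrm{Alg}_m(\mathcal L)\models\bigwedge H\to[\phi=\psi]$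 means: for every $\mathfrak A\in\mathrm{Alg}_m(\mathcal L)$ and every homomorphism $e:\mathfrak F\to\mathfrak A$ (evaluation of the atomic formulas as variables), if $e(\alpha)=e(\beta)$ for all $\langle\alpha,\beta\rangle\in H$ then $e(\phi)=e(\psi)$. *)

(* Defs.v *)
From mathcomp Require Import all_boot.
From mathcomp Require Import boolp classical_sets.

Set Implicit Arguments.
Unset Strict Implicit.
Unset Printing Implicit Defensive.

Local Open Scope classical_set_scope.

Record signature := Signature {
  conn :> Type;
  arity : conn -> nat
}.

Record algebra (Cn : signature) := Algebra {
  carrier :> Type;
  op : forall c : Cn, ('I_(arity c) -> carrier) -> carrier
}.
Arguments op {Cn} _ c _.

Definition is_hom (Cn : signature) (A B : algebra Cn) (h : A -> B) : Prop :=
  forall (c : Cn) (a : 'I_(arity c) -> A),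
    h (op A c a) = op B c (fun i => h (a i)).

(* Freeness of the inductive type subsumes the requirement that no atomic
   formula is a term built from the other atomic formulas. *)
Inductive term (Cn : signature) (P : Type) : Type :=
| Atom (p : P)
| App (c : Cn) (t : 'I_(arity c) -> term Cn P).

Definition term_algebra (Cn : signature) (P : Type) : algebra Cn :=
  @Algebra Cn (term Cn P) (@App Cn P).

Lemma range_op_closed (Cn : signature) (A B : algebra Cn) (h : A -> B)
    (hom_h : is_hom h) (c : Cn) (b : 'I_(arity c) -> {y : B | range h y}) :
  range h (op B c (fun i => sval (b i))).
Proof.
have /fin_all_exists[a ha] i : exists x, h x = sval (b i).
  by case: (b i) => y /= [x _ hx]; exists x.
exists (op A c a) => //.
by rewrite hom_h; congr (op B c _); apply/funext.
Qed.

Definition hom_image (Cn : signature) (A B : algebra Cn) (h : A -> B)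
    (hom_h : is_hom h) : algebra Cn :=
  @Algebra Cn {y : B | range h y}
    (fun c b => exist _ (op B c (fun i => sval (b i))) (range_op_closed hom_h b)).

Record logic := Logic {
  Cn : signature;
  atom : Type;
  model : Type;
  sat : model -> term_algebra Cn atom -> Prop;
  mng_alg : model -> algebra Cn;
  mng : forall M : model, term_algebra Cn atom -> mng_alg M;
  mng_hom : forall M : model, is_hom (@mng M);
  mng_sat : forall (M : model) (phi psi : term_algebra Cn atom),
    mng M phi = mng M psi -> sat M phi -> sat M psi
}.
Arguments mng {l} M _.
Arguments mng_hom {l} M.

Definition formula_algebra (L : logic) : algebra (Cn L) :=
  term_algebra (Cn L) (atom L).
Notation formula L := (carrier (formula_algebra L)).

Definition ker (T U : Type) (h : T -> U) : set (T * T) :=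
  [set e | h e.1 = h e.2].

Definition pair_map (T U : Type) (f : T -> U) (e : T * T) : U * U :=
  (f e.1, f e.2).

Definition Alg_m (L : logic) : algebra (Cn L) -> Prop :=
  fun A => exists M : model L, A = hom_image (mng_hom M).

Section Systems.
Variable L : logic.

Definition relation2 := set (formula L * formula L) -> set (formula L * formula L).

(* The Blok-Pigozzi axioms of a consequence relation: reflexivity, monotonicity
   and cut.  Structurality is the separate notion [substitutional], and
   finitarity is not imposed, as it fails for [entails] in general. *)
Definition deductive_system (D : relation2) : Prop :=
  [/\ forall H e, H e -> D H e,
      forall H K e, H `<=` K -> D H e -> D K e
    & forall H K e, D H e -> (forall e', H e' -> D K e') -> D K e].

Definition closed_under (D : relation2) (S : set (formula L * formula L)) : Prop :=
  forall H e, H `<=` S -> D H e -> S e.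

Definition sound (D : relation2) : Prop :=
  forall M : model L, closed_under D (ker (mng M)).

Definition substitutional (D : relation2) : Prop :=
  forall (f : formula L -> formula L), is_hom f ->
  forall H e, D H e -> D (pair_map f @` H) (pair_map f e).

Definition entails : relation2 := fun H e =>
  forall (f : formula L -> formula L), is_hom f ->
  forall M : model L, pair_map f @` H `<=` ker (mng M) ->
    ker (mng M) (pair_map f e).

End Systems.

Definition valid_implication (Cn : signature) (P : Type)
    (K : algebra Cn -> Prop)
    (H : set (term_algebra Cn P * term_algebra Cn P))
    (phi psi : term_algebra Cn P) : Prop :=
  forall A : algebra Cn, K A ->
  forall e : term_algebra Cn P -> A, is_hom e ->
    (forall alpha beta, H (alpha, beta) -> e alpha = e beta) ->
    e phi = e psi.

(* Main.v *)
Require Import Defs.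
From mathcomp Require Import all_boot.
From mathcomp Require Import boolp classical_sets.

Set Implicit Arguments.
Unset Strict Implicit.
Unset Printing Implicit Defensive.

Local Open Scope classical_set_scope.

(* Since the formula algebra is free over the atoms, it is projective: every
   evaluation of formulas in [mng_M(F)] factors as [mng_M] after an endomorphism
   of [F], and conversely every such composite is an evaluation.  Hence
   quantifying over endomorphisms and models, as in [entails], is the same as
   quantifying over evaluations in [Alg_m L]. *)

Fixpoint term_eval (Cn : signature) (P : Type) (A : algebra Cn) (v : P -> A)
    (t : term Cn P) : A :=
  match t with
  | Atom p => v p
  | App c ts => op A c (fun i => term_eval v (ts i))
  end.

Lemma term_eval_hom (Cn : signature) (P : Type) (A : algebra Cn) (v : P -> A) :
  @is_hom Cn (term_algebra Cn P) A (term_eval v).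
Proof. by []. Qed.

Lemma hom_comp (Cn : signature) (A B C : algebra Cn) (f : A -> B) (g : B -> C) :
  is_hom f -> is_hom g -> is_hom (g \o f).
Proof. by move=> hf hg c a /=; rewrite hf hg. Qed.

Lemma term_hom_ext (Cn : signature) (P : Type) (A : algebra Cn)
    (f g : term_algebra Cn P -> A) :
  is_hom f -> is_hom g -> (forall p, f (Atom Cn p) = g (Atom Cn p)) -> f =1 g.
Proof.
move=> hf hg fg; elim=> [//|c ts IH].
by rewrite (hf c ts) (hg c ts); congr (op A c _); apply/funext.
Qed.

(** By proof irrelevance the membership witness does not matter, so equations in the image algebra
    can be checked in [B]. *)
Lemma hom_image_eq (Cn : signature) (A B : algebra Cn) (h : A -> B)
    (hom_h : is_hom h) (x y : hom_image hom_h) : sval x = sval y -> x = y.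
Proof. by case: x y => [x hx] [y hy] /= xy; apply: eq_exist. Qed.

(** Lifting evaluations needs a surjection, and [h] is onto only after its codomain is cut down to
    the image. *)
Definition corestrict (Cn : signature) (A B : algebra Cn) (h : A -> B)
    (hom_h : is_hom h) (x : A) : hom_image hom_h :=
  exist _ (h x) (imageT h x).

Lemma corestrict_hom (Cn : signature) (A B : algebra Cn) (h : A -> B)
    (hom_h : is_hom h) : is_hom (corestrict hom_h).
Proof. by move=> c a; apply: hom_image_eq; apply: hom_h. Qed.

Lemma corestrict_surj (Cn : signature) (A B : algebra Cn) (h : A -> B)
    (hom_h : is_hom h) (y : hom_image hom_h) :
  exists x, corestrict hom_h x = y.
Proof. by have [x _ hx] := svalP y; exists x; apply: hom_image_eq. Qed.

(** Choose a [g]-preimage of the value of [e] at each atom and extend freely to terms; [g \o f] and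
    [e] are then homomorphisms that agree on the atoms. *)
Lemma term_algebra_projective (Cn : signature) (P : Type) (A B : algebra Cn)
    (g : A -> B) (e : term_algebra Cn P -> B) :
  is_hom g -> (forall y, exists x, g x = y) -> is_hom e ->
  exists2 f : term_algebra Cn P -> A, is_hom f & g \o f =1 e.
Proof.
move=> hg gsurj he.
have [v hv] := choice (fun p => gsurj (e (Atom Cn p))).
exists (term_eval v); first exact: term_eval_hom.
apply: term_hom_ext => //; apply: hom_comp => //; exact: term_eval_hom.
Qed.

Section Entails.
Variable L : logic.

Lemma entails_deductive_system : deductive_system (@entails L).
Proof.
split=> [H e He f _ M fH|H K e HK De f hf M fK|H K e De HK f hf M fK].
- by apply: fH; exists e.
- by apply: De => // _ [x Hx <-]; apply: fK; exists x => //; apply: HK.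
- by apply: De => // _ [x Hx <-]; apply: HK.
Qed.

(** Testing the [f]-image of [H] with an endomorphism [g] amounts to testing [H] with [g \o f]. *)
Lemma entails_substitutional : substitutional (@entails L).
Proof.
move=> f hf H e De g hg M gfH; apply: (De (g \o f)); first exact: hom_comp.
by move=> _ [x Hx <-]; apply: gfH; exists (pair_map f x) => //; exists x.
Qed.

Lemma entails_sound : sound (@entails L).
Proof.
(* Soundness is the instance of [entails] at the identity endomorphism. *)
move=> M H [t s] HM De; apply: (De id) => //.
by move=> _ [[a b] Hab <-]; apply: HM.
Qed.

(** Substitutionality carries a derivation along [f], and soundness at [M] then puts the [f]-image
    of its conclusion in the kernel of [mng M]. *)
Lemma sub_entails (D : relation2 L) :
  substitutional D -> sound D -> forall H e, D H e -> entails H e.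
Proof. by move=> Dsub Dsound H e De f hf M fH; apply: Dsound fH _; apply: Dsub. Qed.

Lemma entails_valid (H : set (formula L * formula L)) (phi psi : formula L) :
  entails H (phi, psi) <-> valid_implication (@Alg_m L) H phi psi.
Proof.
split=> [De _ [M ->] e he eH|V f hf M fH].
  have [f hf fe] := term_algebra_projective (corestrict_hom (mng_hom M))
    (corestrict_surj (hom_h := mng_hom M)) he.
  rewrite -!fe; apply: hom_image_eq; apply: (De f hf M) => _ [[a b] Hab <-].
  by have := eH _ _ Hab; rewrite -!fe => /(congr1 sval).
have he := hom_comp hf (corestrict_hom (mng_hom M)).
(* The premise that the evaluation satisfies [H] stays open until [sval] has turned the conclusion
   into an equation between meanings. *)
have := V _ (ex_intro _ M erefl) _ he _.
move=> /(_ _)/(congr1 sval); apply => a b Hab; apply: hom_image_eq.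
by apply: (fH (pair_map f (a, b))); exists (a, b).
Qed.

End Entails.

Theorem theorem2p5 (L : logic) :
  [/\ deductive_system (@entails L),
      substitutional (@entails L),
      sound (@entails L)
    & forall D : relation2 L,
        deductive_system D -> substitutional D -> sound D ->
        forall H e, D H e -> entails H e]
  /\
  (forall (H : set (formula L * formula L)) (phi psi : formula L),
     entails H (phi, psi) <-> valid_implication (@Alg_m L) H phi psi).
Proof.
split; last exact: entails_valid.
split; [exact: entails_deductive_system | exact: entails_substitutional
       | exact: entails_sound | by move=> D _; apply: sub_entails].
Qed.
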